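(* If $G$ is a finitely generated torsion group (every element has finite order) with infinite girth, then $G_{bound}$ is trivial.
   Context: For a finitely generated group $G$, a finite generating set $S$ of $G$ and $g\in G$, the word-length $l_S(g)$ is the minimal integer $n\ge 0$ such that $g$ is a product of $n$ elements of $S\cup S^{-1}$. $G_{bound}$ denotes the set of all $g\in G$ for which there exists a constant $M>0$ such that $l_S(g)<M$ for every finite generating set $S$ of $G$; it is a subgroup of $G$. Let $\Gamma(G,S)$ be the Cayley graph of $G$ with respect to $S$, with one edge labelled $s$ from $h$ to $hs$ for each $h\in G$, $s\in S$ (so a generator $s$ with $s^2=e$ gives two edges between $h$ and $hs$, and the word $ss$ describes a simple loop of length 2). A simple loop in $\Gamma(G,S)$ is a non-trivial path (edges may be traversed in either direction; a path immediately backtracking along the same edge does not count) starting and ending at the identity $e$ without self-intersections. The girth of $\Gamma(G,S)$ is the minimal length of a simple loop in it. The group $G$ has infinite girth if for every constant $k>0$ there is a finite generating set $S$ of $G$ such that the girth of $\Gamma(G,S)$ is greater than $k$. *)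

(* Defs.v *)
From mathcomp Require Import all_boot finmap.
From mathcomp Require Import boolp classical_sets.

Set Implicit Arguments.
Unset Strict Implicit.
Unset Printing Implicit Defensive.

Local Open Scope group_scope.

(* The minimum of a set of natural numbers as an extended natural number:     *)
(* None stands for +oo, the minimum of the empty set.                         *)
Definition least (P : nat -> Prop) : option nat :=
  if pselect (exists n, `[< P n >]) is left exP then Some (ex_minn exP)
  else None.

Definition enat_lt (m n : option nat) : bool :=
  match m, n with
  | Some i, Some j => i < j
  | Some _, None => true
  | None, _ => false
  end.

Section CayleyGraph.
Variable G : groupType.
Implicit Types (S : {fset G}) (g : G).

Definition is_word S (w : seq G) : bool :=
  all (fun x => (x \in S) || (x^-1 \in S)) w.

Definition generates S : Prop :=
  forall g, exists2 w, is_word S w & \prod_(x <- w) x = g.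

Definition finitely_generated : Prop := exists S, generates S.

Definition word_length S g : option nat :=
  least (fun n => exists w,
    [/\ size w = n, is_word S w & \prod_(x <- w) x = g]).

Definition G_bound : set G :=
  [set g | exists2 M : nat, 0 < M &
    forall S, generates S -> enat_lt (word_length S g) (Some M)]%classic.

(* The edge labelled s from h to h * s is the pair (h, s). An edge with a     *)
(* direction of travel is ((h, s), b), where b = true means that the edge is  *)
(* travelled backwards, i.e., from h * s to h.                                *)
Definition dart : Type := ((G * G) * bool)%type.

Definition dsource (d : dart) : G :=
  let: ((h, s), b) := d in if b then h * s else h.

Definition dtarget (d : dart) : G :=
  let: ((h, s), b) := d in if b then h else h * s.

Definition dlabel (d : dart) : G := d.1.2.

Definition drev (d : dart) : dart := (d.1, ~~ d.2).

Definition dstep (d d' : dart) : bool :=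
  (dtarget d == dsource d') && (d' != drev d).

(* The sources of the darts of a closed path are its vertices, the final      *)
(* return to 1 being omitted.                                                 *)
Definition simple_loop S (p : seq dart) : bool :=
  if p is d :: p' then
    [&& all (fun x => dlabel x \in S) p, path dstep d p',
        dsource d == 1, dtarget (last d p') == 1
      & uniq [seq dsource x | x <- p]]
  else false.

Definition girth S : option nat :=
  least (fun n => exists2 p, simple_loop S p & size p = n).

End CayleyGraph.

Arguments G_bound : clear implicits.

Definition infinite_girth (G : groupType) : Prop :=
  forall k : nat, 0 < k ->
    exists2 S : {fset G}, generates S & enat_lt (Some k) (girth S).

Definition torsion (G : groupType) : Prop :=
  forall g : G, exists2 n : nat, 0 < n & g ^+ n = 1.

(* Main.v *)
Require Import Defs.
From mathcomp Require Import all_boot finmap.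
From mathcomp Require Import boolp classical_sets.

(** An element [g] of finite order [n > 0] that is a product of [m] generators
    is either trivial or forces the girth to be at most [n * m].  Indeed, write
    [g] as a word of length [m] and reduce this word cyclically: the result
    [c] has length at most [m], its value is a conjugate of [g], and no power
    of [c] contains a letter next to its formal inverse
    ([cyclic_reduction], [sorted_word_pow]).  If [g] is nontrivial then [c] is
    nonempty, and its [n]-th power is a nonempty reduced word with value
    [g ^+ n = 1], so it describes a closed path without backtracking; a
    shortest closed piece of that path is a simple loop
    ([reduced_relator_simple_loop]).

    An element of [G_bound] has length below a constant [M] for all finite
    generating sets at once.  When it has finite order [n], infinite girth
    provides a generating set whose girth exceeds [n * M], and for this set
    the first alternative is the only one possible.

    The words below are words in formal letters [s] and [s^-1], kept apart from
    their values in the group: when [s] is an involution the word [s s] is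
    reduced and traces a simple loop of length 2, whereas [s s^-1] backtracks,
    although both have the same sequence of values. *)

Set Implicit Arguments.
Unset Strict Implicit.
Unset Printing Implicit Defensive.

Local Open Scope group_scope.

(** * Minima of sets of natural numbers *)

Lemma least_lt_ex (P : nat -> Prop) m :
  enat_lt (least P) (Some m) -> exists2 n, P n & (n < m)%N.
Proof.
rewrite /least; case: pselect => //= exP.
by case: ex_minnP => n /asboolP Pn _ lt_nm; exists n.
Qed.

Lemma lt_least (P : nat -> Prop) k n :
  enat_lt (Some k) (least P) -> P n -> (k < n)%N.
Proof.
rewrite /least => lt_k Pn; case: pselect lt_k => [exP|[]]; last first.
  by exists n; apply/asboolP.
case: ex_minnP => i _ min_i /= lt_ki.
by apply: leq_trans lt_ki (min_i _ _); apply/asboolP.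
Qed.

(** * Relations on consecutive entries of a sequence *)

Lemma not_path_split (T : Type) (e : rel T) x p : ~~ path e x p ->
  exists p1 y z p2, x :: p = p1 ++ y :: z :: p2 /\ ~~ e y z.
Proof.
elim: p x => //= z p IHp x; rewrite negb_and => /orP[nexz|/IHp].
  by exists [::], x, z, p.
by move=> [p1 [y [t [p2 [-> neyt]]]]]; exists (x :: p1), y, t, p2.
Qed.

Lemma path_flatten_nseq (T : Type) (e : rel T) n x p :
  cycle e (x :: p) -> path e (last x p) (flatten (nseq n (x :: p))).
Proof.
rewrite /= rcons_path => /andP[e_p e_lx].
by elim: n => //= n IHn; rewrite e_lx cat_path e_p.
Qed.

Section Words.
Variable G : groupType.
Implicit Types (a b : G * bool) (w c : seq (G * bool)) (h : G) (S : {fset G}).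

(** * Words in formal letters *)

(** The boolean has the same meaning as in darts: [true] marks a formal
    inverse, that is, an edge travelled backwards. *)
Definition letter_val a : G := if a.2 then a.1^-1 else a.1.

Definition word_val w : G := \prod_(a <- w) letter_val a.

Definition formal_inv a : G * bool := (a.1, ~~ a.2).

Definition no_cancel a b : bool := b != formal_inv a.

Definition letters_in S w : bool := all (fun a => a.1 \in S) w.

Lemma word_val_nil : word_val [::] = 1.
Proof. by rewrite /word_val big_nil. Qed.

Lemma word_val_cons a w : word_val (a :: w) = letter_val a * word_val w.
Proof. by rewrite /word_val big_cons. Qed.

Lemma word_val_cat w1 w2 : word_val (w1 ++ w2) = word_val w1 * word_val w2.
Proof. by rewrite /word_val big_cat. Qed.

Lemma word_val_pow n w : word_val (flatten (nseq n w)) = word_val w ^+ n.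
Proof.
by elim: n => [|n IHn] /=; rewrite ?word_val_nil // word_val_cat IHn expgS.
Qed.

Lemma letter_val_inv a : letter_val (formal_inv a) = (letter_val a)^-1.
Proof. by case: a => s []; rewrite /letter_val /= ?invgK. Qed.

Lemma letters_in_pow S n w :
  letters_in S w -> letters_in S (flatten (nseq n w)).
Proof.
by move=> Sw; elim: n => //= n IHn; rewrite /letters_in all_cat; apply/andP.
Qed.

Lemma formal_word S (v : seq G) : is_word S v ->
  exists w, [/\ letters_in S w, size w = size v
    & word_val w = \prod_(x <- v) x].
Proof.
elim: v => [|x v IHv] /=.
  by exists [::]; split; rewrite ?word_val_nil ?big_nil.
move=> /andP[Sx /IHv[w [Sw szw valw]]].
case/orP: Sx => Sx; [exists ((x, false) :: w) | exists ((x^-1, true) :: w)];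
  by split; rewrite /= ?Sx ?szw // word_val_cons big_cons valw //
    /letter_val /= ?invgK.
Qed.

(** * Cyclic reduction *)

(** A word that is not cyclically reduced contains a letter and its formal
    inverse either side by side, where deleting both keeps the value, or at
    its two ends, where deleting both conjugates the value. *)
Lemma cyclic_reduction S w : letters_in S w ->
  exists c h, [/\ letters_in S c, (size c <= size w)%N, cycle no_cancel c
    & word_val c = word_val w ^ h].
Proof.
have [n] := ubnP (size w); elim: n w => // n IHn w le_wn Sw.
have [red_w | nred_w] := boolP (cycle no_cancel w).
  by exists w, 1; rewrite conjg1.
suff [w' [h [Sw' lt_w'w valw']]] : exists w' h,
    [/\ letters_in S w', (size w' < size w)%N & word_val w' = word_val w ^ h].
  have [|c [k [Sc le_cw' red_c valc]]] := IHn w' _ Sw'.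
    exact: leq_trans lt_w'w le_wn.
  exists c, (h * k); split=> //; first exact: leq_trans le_cw' (ltnW lt_w'w).
  by rewrite valc valw' conjgM.
case: w nred_w Sw {le_wn} => // a p; rewrite [cycle _ _]/= rcons_path negb_and.
case/orP=> [nred_p | canc].
  have [p1 [b [b' [p2 [-> canc]]]]] := not_path_split nred_p.
  move: canc; rewrite negbK => /eqP->.
  rewrite /letters_in all_cat /= => /and4P[Sp1 _ _ Sp2].
  exists (p1 ++ p2), 1; rewrite all_cat Sp1 Sp2 !size_cat /=.
  split=> //; first by rewrite ltn_add2l ltnS leqnSn.
  by rewrite conjg1 !word_val_cat !word_val_cons letter_val_inv mulVKg.
(* A one-letter word never gets here: a letter is not its own formal inverse. *)
case/lastP: p canc => [|p b]; first by rewrite negbK; case: a => s [] /eqP[].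
rewrite last_rcons negbK => /eqP->; rewrite /letters_in /= all_rcons.
move=> /and3P[_ _ Sp].
exists p, (letter_val (formal_inv b)); split=> //.
  by rewrite /= size_rcons.
rewrite word_val_cons -cats1 word_val_cat word_val_cons word_val_nil mulg1.
by rewrite letter_val_inv conjgE invgK !mulgA mulgV mul1g mulgK.
Qed.

Lemma sorted_word_pow n c :
  cycle no_cancel c -> sorted no_cancel (flatten (nseq n c)).
Proof.
case: c => [|a c] red_c; first by elim: n.
exact: path_sorted (path_flatten_nseq n red_c).
Qed.

(** * Paths traced by words *)

(** The dart leaving [h] that reads [a]; travelled backwards, its edge is based
    at the far end. *)
Definition dart_of h a : dart G :=
  ((if a.2 then h * letter_val a else h, a.1), a.2).

Fixpoint trace h w : seq (dart G) :=
  if w is a :: w' then dart_of h a :: trace (h * letter_val a) w' else [::].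

Lemma dsource_dart_of h a : dsource (dart_of h a) = h.
Proof. by case: a => s [] //=; rewrite /letter_val /= mulgVK. Qed.

Lemma dtarget_dart_of h a : dtarget (dart_of h a) = h * letter_val a.
Proof. by case: a => s []. Qed.

Arguments dsource : simpl never.
Arguments dtarget : simpl never.

Lemma dstep_dart_of h a b :
  no_cancel a b -> dstep (dart_of h a) (dart_of (h * letter_val a) b).
Proof.
move=> nc_ab; rewrite /dstep dtarget_dart_of dsource_dart_of eqxx /=.
apply: contra nc_ab; case: b => t b /eqP[_ -> ->].
by rewrite /formal_inv.
Qed.

Lemma size_trace h w : size (trace h w) = size w.
Proof. by elim: w h => //= a w IHw h; rewrite IHw. Qed.

Lemma all_dlabel_trace S h w :
  letters_in S w -> all (fun d => dlabel d \in S) (trace h w).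
Proof. by elim: w h => //= a w IHw h /andP[Sa Sw]; rewrite [_ \in S]Sa IHw. Qed.

Lemma path_trace h a w : path no_cancel a w ->
  path (@dstep G) (dart_of h a) (trace (h * letter_val a) w).
Proof.
by elim: w h a => //= b w IHw h a /andP[nc_ab /IHw->]; rewrite dstep_dart_of.
Qed.

Lemma dtarget_last_trace h a w :
  dtarget (last (dart_of h a) (trace (h * letter_val a) w))
    = h * word_val (a :: w).
Proof.
elim: w h a => [|b w IHw] h a /=.
  by rewrite dtarget_dart_of word_val_cons word_val_nil mulg1.
by rewrite IHw [word_val (a :: _)]word_val_cons mulgA.
Qed.

Lemma mem_sources_trace h w k : k \in map (@dsource G) (trace h w) ->
  exists w1 w2, [/\ w = w1 ++ w2, (0 < size w2)%N & k = h * word_val w1].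
Proof.
elim: w h => //= a w IHw h; rewrite inE dsource_dart_of.
case/predU1P=> [-> | /IHw[w1 [w2 [-> sz_w2 ->]]]].
  by exists [::], (a :: w); rewrite word_val_nil mulg1.
by exists (a :: w1), w2; rewrite word_val_cons mulgA.
Qed.

(** Two occurrences of the same source cut out a factor of trivial value.  This
    factor is proper because the list of sources omits the final vertex. *)
Lemma trivial_factor h w : ~~ uniq (map (@dsource G) (trace h w)) ->
  exists w1 v w2, [/\ w = w1 ++ v ++ w2, (0 < size v < size w)%N
    & word_val v = 1].
Proof.
elim: w h => //= a w IHw h; rewrite negb_and negbK dsource_dart_of.
case/orP=> [/mem_sources_trace[w1 [w2 [-> sz_w2 eq_h]]] | /IHw].
  exists [::], (a :: w1), w2; split=> //=.
    by rewrite size_cat ltnS -[X in (X < _)%N]addn0 ltn_add2l.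
  by apply: (mulgI h); rewrite word_val_cons mulgA -eq_h mulg1.
move=> [w1 [v [w2 [-> /andP[sz_v lt_v] valv]]]].
by exists (a :: w1), v, w2; rewrite sz_v ltnS ltnW.
Qed.

(** A shortest nonempty factor of trivial value visits pairwise distinct
    vertices, and as a factor of [w] it is still reduced, so its path never
    backtracks. *)
Lemma reduced_relator_simple_loop S w : letters_in S w -> w != [::] ->
    sorted no_cancel w -> word_val w = 1 ->
  exists2 p, simple_loop S p & (size p <= size w)%N.
Proof.
have [n] := ubnP (size w); elim: n w => // n IHn w le_wn Sw nz_w red_w valw.
have [uniq_w | /trivial_factor] := boolP (uniq (map (@dsource G) (trace 1 w))).
  exists (trace 1 w); last by rewrite size_trace.
  case: w Sw nz_w red_w valw uniq_w {le_wn} => // a w Sw _ red_w valw uniq_w.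
  have Sd := all_dlabel_trace 1 Sw; apply/and5P; split=> //=.
  - exact: path_trace.
  - by rewrite dsource_dart_of.
  - by rewrite dtarget_last_trace mul1g valw.
move=> [w1 [v [w2 [def_w /andP[sz_v lt_vw] valv]]]].
have [| | | | p loop_p le_pv] := IHn v _ _ _ _ valv.
- exact: leq_trans lt_vw le_wn.
- by move: Sw; rewrite def_w /letters_in !all_cat => /and3P[].
- by rewrite -size_eq0 -lt0n.
- by move: red_w; rewrite def_w => /cat_sorted2[_] /cat_sorted2[].
by exists p; last exact: leq_trans le_pv (ltnW lt_vw).
Qed.

(** * Torsion elements bound the girth *)

(** The powers of a cyclically reduced conjugate are reduced without any loss
    of length, so the bound depends only on the order and on [size v]. *)
Lemma torsion_simple_loop S (v : seq G) n : is_word S v ->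
    (0 < n)%N -> (\prod_(x <- v) x) ^+ n = 1 -> \prod_(x <- v) x != 1 ->
  exists2 p, simple_loop S p & (size p <= n * size v)%N.
Proof.
move=> /formal_word[w [Sw <- <-]] n_gt0 val_n val_neq1.
have [c [h [Sc le_cw red_c valc]]] := cyclic_reduction Sw.
have nz_c : (0 < size c)%N.
  by case: c valc {Sc le_cw red_c} => // /esym/eqP;
    rewrite word_val_nil conjg_eq1 (negPf val_neq1).
have sz_pow : size (flatten (nseq n c)) = (n * size c)%N.
  by rewrite size_flatten /shape map_nseq sumn_nseq mulnC.
have [||||p loop_p le_p] := @reduced_relator_simple_loop S (flatten (nseq n c)).
- exact: letters_in_pow.
- by rewrite -size_eq0 sz_pow -lt0n muln_gt0 n_gt0.
- exact: sorted_word_pow.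
- by rewrite word_val_pow valc -conjXg val_n conj1g.
exists p => //; apply: leq_trans le_p _.
by rewrite sz_pow leq_mul2l le_cw orbT.
Qed.

Lemma G_bound1 : G_bound G 1.
Proof.
exists 1%N => // S _; rewrite /word_length /least; case: pselect => [exP|[]].
  case: ex_minnP => m _ min_m /=; rewrite ltnS; apply: min_m.
  by apply/asboolP; exists [::]; rewrite big_nil.
by exists 0%N; apply/asboolP; exists [::]; rewrite big_nil.
Qed.

End Words.

Theorem corollary3p3 (G : groupType) :
  finitely_generated G -> torsion G -> infinite_girth G ->
  G_bound G = [set 1%g]%classic.
Proof.
move=> _ torG girthG; apply/seteqP; split=> g; last first.
  by move=> ->; exact: G_bound1.
move=> [M M_gt0 boundM]; apply/eqP/negPn/negP => g_neq1.
have [n n_gt0 gn1] := torG g.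
have [|S genS lt_girth] := girthG (n * M)%N; first by rewrite muln_gt0 n_gt0.
have [m [v [szv Sv valv]] lt_mM] := least_lt_ex (boundM S genS).
have [||p loop_p le_p] := torsion_simple_loop Sv n_gt0; rewrite ?valv //.
have lt_p : (n * M < size p)%N by apply: lt_least lt_girth _; exists p.
have: (n * M < n * m)%N by rewrite -szv; exact: leq_trans lt_p le_p.
by rewrite ltn_mul2l n_gt0 ltnNge ltnW.
Qed.
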